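(* Let $s,t$ be integers with $2\le s\le t$. Then the complete bipartite graph $K_{s,t}$ is power-critical if and only if $\varphi(s+t)\ge s-1$, where $\varphi$ is Euler's totient function.
   Context: Graphs are finite, simple and undirected. The power graph $\Gamma_G$ of a group $G$ has vertex set $G$, and two distinct elements are adjacent if one is a power of the other. An embedding of a graph $\Gamma_1$ into a graph $\Gamma_2$ is an injection $f:V(\Gamma_1)\to V(\Gamma_2)$ such that $\{x,y\}\in E(\Gamma_1)$ implies $\{f(x),f(y)\}\in E(\Gamma_2)$ (the image need not be an induced subgraph). The power index $\Theta(\Gamma)$ of a graph $\Gamma$ is the least order of a group $G$ such that $\Gamma$ embeds into $\Gamma_G$. A graph $\Gamma$ is power-critical if $|V(\Gamma)|=\Theta(\Gamma)$. *)

(* Defs.v *)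
From HB Require Import structures.
From mathcomp Require Import all_boot all_fingroup all_solvable all_algebra.
From mathcomp Require Import boolp.

Set Implicit Arguments.
Unset Strict Implicit.
Unset Printing Implicit Defensive.

Record sgraph := SGraph {
  vertex :> finType;
  adj : rel vertex;
  adj_sym : symmetric adj;
  adj_irr : irreflexive adj
}.

Definition embeds (G H : sgraph) : Prop :=
  exists f : G -> H,
    injective f /\ forall x y : G, adj x y -> adj (f x) (f y).

(* In a finite group <[y]> is exactly the set of powers of y (cycleP). *)
Definition power_adj (gT : finGroupType) : rel gT :=
  fun x y => (x != y) && ((x \in <[y]>%g) || (y \in <[x]>%g)).

Lemma power_adj_sym (gT : finGroupType) : symmetric (@power_adj gT).
Proof. by move=> x y; rewrite /power_adj eq_sym orbC. Qed.

Lemma power_adj_irr (gT : finGroupType) : irreflexive (@power_adj gT).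
Proof. by move=> x; rewrite /power_adj eqxx. Qed.

Definition power_graph (gT : finGroupType) : sgraph :=
  SGraph (@power_adj_sym gT) (@power_adj_irr gT).

Definition embeds_in_order (G : sgraph) (n : nat) : Prop :=
  exists gT : finGroupType, #|gT| = n /\ embeds G (power_graph gT).

(* The power graph of a cyclic 2-group is complete, so every finite graph
   embeds into the power graph of some finite group. *)
Lemma embeds_in_some_order (G : sgraph) : exists n, `[< embeds_in_order G n >].
Proof.
pose N := (2 ^ #|G|.+1)%N.
have N_gt1 : 1 < N by rewrite /N (ltn_exp2l 0).
have cardZ : #|'Z_N| = N by rewrite card_ord Zp_cast.
have ltN (x : G) : enum_rank x < (Zp_trunc N).+2.
  rewrite Zp_cast //; apply: ltn_trans (ltn_ord _) _.
  by rewrite /N; apply: ltn_trans (ltn_expl _ _).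
exists N; apply/asboolP; exists 'Z_N; split=> //.
exists (fun x => Ordinal (ltN x)); split=> [x y [/val_inj]|x y xy].
  exact: enum_rank_inj.
rewrite /adj /= /power_adj; apply/andP; split.
  apply: contraTneq xy => -[/val_inj/enum_rank_inj ->].
  by rewrite adj_irr.
set a := Ordinal _; set b := Ordinal _.
have cyc : cyclic [set: 'Z_N].
  by apply/cyclicP; exists Zp1; rewrite -Zp_cycle.
have dvdN (c : 'Z_N) : exists i, #[c]%g = (2 ^ i)%N.
  have : #[c]%g %| #|[set: 'Z_N]| by rewrite order_dvdG ?inE.
  by rewrite cardsT cardZ => /(dvdn_pfactor _ _ (isT : prime 2)) [i _ ->]; exists i.
have subE (c d : 'Z_N) : (c \in <[d]>%g) = (#[c]%g %| #[d]%g).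
  rewrite -cycle_subG; apply/esym/(cardSg_cyclic cyc); exact: subsetT.
case: (dvdN a) (dvdN b) => [i ai] [j bj].
rewrite !subE ai bj !dvdn_Pexp2l //.
exact: leq_total.
Qed.

Definition power_index (G : sgraph) : nat := ex_minn (embeds_in_some_order G).

Definition power_critical (G : sgraph) : Prop := #|G| = power_index G.

Definition bipartite_adj (s t : nat) : rel ('I_s + 'I_t)%type :=
  fun x y => match x, y with
             | inl _, inr _ | inr _, inl _ => true
             | _, _ => false
             end.

Lemma bipartite_adj_sym (s t : nat) : symmetric (@bipartite_adj s t).
Proof. by case=> ? [] ?. Qed.

Lemma bipartite_adj_irr (s t : nat) : irreflexive (@bipartite_adj s t).
Proof. by case. Qed.

Definition complete_bipartite (s t : nat) : sgraph :=
  SGraph (@bipartite_adj_sym s t) (@bipartite_adj_irr s t).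

(* Main.v *)
Require Import Defs.
From mathcomp Require Import all_boot.
From mathcomp Require Import all_fingroup all_solvable zmodp boolp zify.

(** Put n = s + t. The graph is power-critical iff some group of order n splits
    into parts of sizes s and t with all cross pairs adjacent in the power
    graph. If n is a prime power then phi(n) >= n/2 >= s. Otherwise any two
    elements that are neither trivial nor generators are joined by a path of
    non-adjacent pairs: elements of prime order link up through distinct primes,
    an element whose order misses a prime p is not adjacent to an element of
    order p, and an element x whose order is divisible by every prime is not
    adjacent to any p-element outside <x>. Hence one part consists of the
    identity and generators only. Conversely, in the cyclic group of order n
    the identity and the generators are adjacent to everything. *)

Set Implicit Arguments.
Unset Strict Implicit.
Unset Printing Implicit Defensive.

(** An embedding is injective, so the index is never below [#|G|]; criticality only asks that this
    bound be attained. *)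
Lemma power_criticalE (G : sgraph) : power_critical G <-> embeds_in_order G #|G|.
Proof.
rewrite /power_critical /power_index; case: ex_minnP => m /asboolP Gm min_m.
split=> [-> //|/asboolT/min_m le_mG].
apply/eqP; rewrite eqn_leq le_mG andbT.
by case: Gm => gT [<- [f [f_inj _]]]; apply: leq_card f_inj.
Qed.

Section NonadjacentConnectivity.
Local Open Scope group_scope.

(** [c] will be the side of the bipartition on which an element lies: cross pairs are adjacent, so
    non-adjacent elements share a side. *)
Variables (gT : finGroupType) (c : gT -> bool).
Hypothesis c_nonadj : forall x y, x \notin <[y]> -> y \notin <[x]> -> c x = c y.

Lemma order_nonadj_same (x y : gT) :
  ~~ (#[x] %| #[y])%N -> ~~ (#[y] %| #[x])%N -> c x = c y.
Proof.
by move=> xy yx; apply: c_nonadj; [apply: contra xy | apply: contra yx];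
   apply: order_dvdG.
Qed.

Variables p q : nat.
Hypotheses (p_pr : prime p) (q_pr : prime q) (neq_pq : p != q).
Hypotheses (p_dv : (p %| #|gT|)%N) (q_dv : (q %| #|gT|)%N).

Lemma prime_order_same (x y : gT) : prime #[x] -> prime #[y] -> c x = c y.
Proof.
move=> x_pr y_pr.
have neqP (u v : gT) : prime #[u] -> prime #[v] -> #[u] != #[v] -> c u = c v.
  move=> u_pr v_pr uv.
  by apply: order_nonadj_same; rewrite dvdn_prime2 // eq_sym.
have [xy|] := eqVneq #[x] #[y]; last exact: neqP.
(* Elements of equal prime order are linked through one of another prime order, which Cauchy
   provides because two primes divide [#|gT|]. *)
have [r [r_pr r_dv neq_xr]] :
    exists r, [/\ prime r, (r %| #|[set: gT]|)%N & #[x] != r].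
  rewrite cardsT; have [xp|] := eqVneq #[x] p; last by exists p.
  by exists q; rewrite xp.
have [z _ oz] := Cauchy r_pr r_dv.
by rewrite (neqP x z) -?(neqP y z) // ?oz // -xy.
Qed.

Lemma nondividing_order_same (r : nat) (x z : gT) :
    x != 1 -> prime r -> (r %| #|gT|)%N -> ~~ (r %| #[x])%N ->
  prime #[z] -> c x = c z.
Proof.
move=> ntx r_pr r_dv rNx z_pr; have [|u _ ou] := @Cauchy _ r [set: gT] r_pr.
  by rewrite cardsT.
rewrite -(@prime_order_same u z) ?ou //; apply: order_nonadj_same; rewrite ou //.
apply/negP => /(primeP r_pr).2 /pred2P[/eqP|xr].
  by rewrite order_eq1 (negPf ntx).
by rewrite xr dvdnn in rNx.
Qed.

(** An element is the product of its constituents, so they cannot all lie in [<[x]>] when it does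
    not. *)
Lemma constt_notin_cycle (x : gT) :
  <[x]> != [set: gT] -> exists g, exists r : nat, g.`_r \notin <[x]>.
Proof.
rewrite eqEsubset subsetT /= => /subsetPn[g _ gNx]; exists g.
apply: contrapT => /forallNP in_x; case/negP: gNx.
rewrite -(prod_constt g); apply: group_prod => r _.
by apply: contraT => /in_x.
Qed.

Lemma nongenerator_same (x z : gT) :
  x != 1 -> <[x]> != [set: gT] -> prime #[z] -> c x = c z.
Proof.
move=> ntx nGx z_pr.
have [px|pNx] := boolP (p %| #[x])%N; last exact: (nondividing_order_same ntx p_pr).
have [qx|qNx] := boolP (q %| #[x])%N; last exact: (nondividing_order_same ntx q_pr).
have [g [r gNx]] := constt_notin_cycle nGx; set h := g.`_r in gNx.
have nt_h : h != 1 by apply: contraNneq gNx => ->.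
(* A prime [r'] dividing [#[x]] cannot divide the order of the [r]-element [h]. This keeps [x] out
   of [<[h]>] and also puts [h] on the side of [z]. *)
have [r' [r'_pr r'_dv r'x neq_r]] :
    exists r', [/\ prime r', (r' %| #|gT|)%N, (r' %| #[x])%N & r' != r].
  by have [pr|] := eqVneq p r; [exists q; rewrite -pr eq_sym | exists p].
have r'Nh : ~~ (r' %| #[h])%N.
  by apply: contra neq_r; apply: (pnatP _ (order_gt0 h) (p_elt_constt r g)).
rewrite -(nondividing_order_same nt_h r'_pr r'_dv r'Nh z_pr).
apply: c_nonadj => //; apply: contra r'Nh => /order_dvdG.
exact: dvdn_trans.
Qed.

End NonadjacentConnectivity.

Definition dominating (gT : finGroupType) : {set gT} :=
  [set x | (x == 1%g) || (<[x]>%g == [set: gT])].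

Lemma card_generators (gT : finGroupType) (x : gT) :
  <[x]>%g = [set: gT] -> #|[set y : gT | <[y]>%g == [set: gT]]| = totient #|gT|.
Proof.
move=> genx; rewrite -cardsT -genx -/(order x) totient_gen.
by apply: eq_card => y; rewrite !inE /generator eq_sym genx.
Qed.

Lemma card_dominating (gT : finGroupType) : #|dominating gT| <= (totient #|gT|).+1.
Proof.
have -> : dominating gT = 1%g |: [set y : gT | <[y]>%g == [set: gT]].
  by apply/setP=> x; rewrite !inE.
rewrite (leq_trans (leq_card_setU _ _)) // cards1 ltnS.
have [->|[x]] := set_0Vmem [set y : gT | <[y]>%g == [set: gT]].
  by rewrite cards0.
by rewrite inE => /eqP /card_generators ->.
Qed.

(** In a nontrivial group the identity is not a generator, so it adds exactly one to the count. *)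
Lemma card_dominating_cyclic (gT : finGroupType) :
  1 < #|gT| -> cyclic [set: gT] -> #|dominating gT| = (totient #|gT|).+1.
Proof.
move=> gT_gt1 /cyclicP[x /esym genx].
have -> : dominating gT = 1%g |: [set y : gT | <[y]>%g == [set: gT]].
  by apply/setP=> y; rewrite !inE.
rewrite cardsU1 inE (card_generators genx) -add1n; congr (_ + _).
rewrite cycle1 (contraTneq _ gT_gt1) // => /(congr1 (fun A : {set gT} => #|A|)).
by rewrite cardsT cards1 => <-.
Qed.

Lemma dominating_adj (gT : finGroupType) (x y : gT) :
  x \in dominating gT -> x != y -> power_adj x y.
Proof.
rewrite inE /power_adj => /orP[/eqP->|/eqP->] ->; first by rewrite group1.
by rewrite inE orbT.
Qed.

Lemma prime_power_leq_totient (p k : nat) :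
  prime p -> p ^ k.+1 <= 2 * totient (p ^ k.+1).
Proof.
move=> p_pr; rewrite totient_pfactor //= expnS mulnA leq_mul2r.
by case: p p_pr => [|[|p]] // _; apply/orP; right; lia.
Qed.

Lemma two_prime_divisors (n p : nat) :
    0 < n -> prime p -> p %| n -> (forall k, n != p ^ k.+1) ->
  exists q, [/\ prime q, q %| n & p != q].
Proof.
move=> n_gt0 p_pr p_dv npow.
have : ~~ p.-nat n.
  apply/negP => /p_natP[[|k] nk]; last by have /eqP := npow k.
  by rewrite nk expn0 Euclid_dvd1 in p_dv.
rewrite /pnat n_gt0 => /allPn[q]; rewrite mem_primes => /and3P[q_pr _ q_dv] qp.
by exists q; split=> //; rewrite eq_sym.
Qed.

Lemma bipartite_embeds_totient (s t : nat) :
    2 <= s -> s <= t -> embeds_in_order (complete_bipartite s t) (s + t) ->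
  s <= (totient (s + t)).+1.
Proof.
move=> hs hst [gT [cardG [f [f_inj f_adj]]]].
have n_gt1 : 1 < s + t by lia.
set p := pdiv (s + t); have p_pr : prime p := pdiv_prime n_gt1.
have p_dv : p %| s + t := pdiv_dvd _.
(* For a prime power, [2 * s <= s + t <= 2 * totient (s + t)]. *)
have [[k /eqP nk]|npow] := pselect (exists k, s + t == p ^ k.+1).
  by have := prime_power_leq_totient k p_pr; rewrite -nk; lia.
have [q [q_pr q_dv neq_pq]] : exists q, [/\ prime q, q %| s + t & p != q].
  apply: two_prime_divisors => // [|k]; first by lia.
  by apply/negP=> nk; apply: npow; exists k.
(* Equal cardinalities make [f] bijective, so every group element lies on a side. *)
have [|g fK gK] := inj_card_bij f_inj.
  by rewrite cardG card_sum !card_ord.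
pose c y := if g y is inl _ then true else false.
have c_nonadj x y : x \notin <[y]>%g -> y \notin <[x]>%g -> c x = c y.
  move=> xy yx; apply/eqP; apply: contraT => neq_c.
  have : adj (f (g x)) (f (g y)).
    by apply: f_adj; move: neq_c; rewrite /c; case: (g x); case: (g y).
  by rewrite !gK /= /power_adj (negPf xy) (negPf yx) andbF.
rewrite -cardG in p_dv q_dv.
have [|z _ oz] := @Cauchy _ p [set: gT] p_pr; first by rewrite cardsT.
have c_const x : x \notin dominating gT -> c x = c z.
  rewrite inE negb_or => /andP[ntx nGx].
  by apply: (nongenerator_same c_nonadj p_pr q_pr) => //; rewrite oz.
rewrite -cardG; apply: leq_trans (card_dominating gT).
(* The side that misses [z] consists of dominating elements; it has size [s] or [t], hence at least
   [s]. *)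
have side_sub (m : nat) (i : 'I_m -> 'I_s + 'I_t) :
    injective i -> (forall j, c (f (i j)) != c z) -> m <= #|dominating gT|.
  move=> i_inj ci; rewrite -[m]card_ord -(card_codom (inj_comp f_inj i_inj)).
  apply/subset_leq_card/subsetP => _ /codomP[j ->].
  by apply: contraR (ci j) => /c_const ->.
case cz: (c z) in side_sub.
  by apply/(leq_trans hst)/(side_sub _ inr) => [? ? []|j] //; rewrite /c fK.
by apply/(side_sub _ inl) => [? ? []|j] //; rewrite /c fK.
Qed.

Lemma totient_bipartite_embeds (s t : nat) :
    2 <= s -> s <= (totient (s + t)).+1 ->
  embeds_in_order (complete_bipartite s t) (s + t).
Proof.
move=> hs le_s_phi; set n := s + t in le_s_phi *.
have n_gt1 : 1 < n by rewrite /n; lia.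
pose Z : finGroupType := 'Z_n.
have cardZ : #|Z| = n by apply: etrans (card_ord _) _; rewrite Zp_cast.
have cycZ : cyclic [set: Z] by apply/cyclicP; exists Zp1; rewrite -Zp_cycle.
exists Z; split=> //; pose D := dominating Z.
have cardD : #|D| = (totient n).+1 by rewrite card_dominating_cyclic ?cardZ.
(* [unsplit] numbers the left vertices first, so listing [D] first sends all [s] of them into [D].
   The indices stay below [size e], so the default of [nth] is never reached. *)
pose e := enum D ++ enum (~: D).
have size_e : size e = n by rewrite size_cat -!cardE cardsC.
have uniq_e : uniq e.
  rewrite cat_uniq !enum_uniq andbT /=; apply/hasPn => x.
  by rewrite !mem_enum inE.
pose f (v : complete_bipartite s t) : Z := nth 1%g e (val (unsplit v)).
have f_inj : injective f.
  move=> u v /eqP; rewrite nth_uniq ?size_e ?ltn_ord // => /eqP/val_inj.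
  exact: (can_inj unsplitK).
exists f; split=> // x y.
have inD (i : 'I_s) : f (inl i) \in D.
  have i_lt : i < size (enum D).
    by rewrite -cardE cardD (leq_trans (ltn_ord i)).
  by rewrite /f /= nth_cat i_lt -mem_enum mem_nth.
have inl_adj i j : power_adj (f (inl i)) (f (inr j)).
  by apply: dominating_adj => //; apply/eqP => /f_inj.
by case: x y => [i|i] [j|j] //= _; rewrite power_adj_sym.
Qed.

Theorem theorem3p5 (s t : nat) (hs : 2 <= s) (hst : s <= t) :
  power_critical (complete_bipartite s t) <-> s - 1 <= totient (s + t).
Proof.
rewrite power_criticalE card_sum !card_ord.
rewrite (_ : (s - 1 <= _) = (s <= (totient (s + t)).+1)); last by lia.
split; first exact: bipartite_embeds_totient.
exact: totient_bipartite_embeds.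
Qed.
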